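(* Let $i, j$ be positive integers with $(i,j)\neq(1,1)$, and let $n_1,n_2,n_3$ be positive integers with $n_1\geq n_2\geq n_3$. Then the complete tripartite graph $K_{n_1,n_2,n_3}$ is $(i,j)$-step competitively orientable if and only if one of the following holds: (a) $n_3\geq 2$; (b) $n_2\geq 3$ and $n_3=1$; (c) $i\geq 2$, $j\geq 2$, $n_1\geq 4$, $n_2=2$, and $n_3=1$.
   Context: Graphs are finite, without loops or multiple edges; digraphs are finite, without loops, directed $2$-cycles, or multiple arcs. An orientation of a graph $G$ is a digraph whose underlying graph is $G$ (each edge is replaced by exactly one of its two possible arcs). For a digraph $D$, $d_D(u,v)$ is the number of arcs in a shortest directed path from $u$ to $v$ in $D$. For positive integers $i,j$, two (distinct) vertices $u,v$ of $D$ $(i,j)$-step compete if there is a vertex $w$ (distinct from $u$ and $v$) such that either $1\le d_{D-v}(u,w)\le i$ and $1\le d_{D-u}(v,w)\le j$, or $1\le d_{D-v}(u,w)\le j$ and $1\le d_{D-u}(v,w)\le i$; here $D-x$ is $D$ with the vertex $x$ deleted. $D$ is $(i,j)$-step competitive if any two vertices of $D$ $(i,j)$-step compete. A graph $G$ is $(i,j)$-step competitively orientable if some orientation of $G$ is $(i,j)$-step competitive. $K_{n_1,n_2,n_3}$ is the complete tripartite graph with partite sets of sizes $n_1,n_2,n_3$. *)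

(* Defs.v *)
From mathcomp Require Import all_boot.
Set Implicit Arguments.
Unset Strict Implicit.
Unset Printing Implicit Defensive.

Record graph (V : finType) := Graph {
  adj :> rel V;
  adj_sym : symmetric adj;
  adj_irrefl : irreflexive adj }.

(* The second axiom excludes directed 2-cycles and (taking u = v) loops. *)
Record digraph (V : finType) := Digraph {
  arc :> rel V;
  arc_asym : forall u v, arc u v -> ~~ arc v u }.

Section Digraphs.

Variable V : finType.
Implicit Types (D : digraph V) (G : graph V).

Lemma arc_irrefl D : irreflexive D.
Proof. by move=> u; apply/negP => h; move/negP: (arc_asym h); apply. Qed.

Definition underlying_rel D : rel V := fun u v => D u v || D v u.

Lemma underlying_sym D : symmetric (underlying_rel D).
Proof. by move=> u v; rewrite /underlying_rel orbC. Qed.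

Lemma underlying_irrefl D : irreflexive (underlying_rel D).
Proof. by move=> u; rewrite /underlying_rel arc_irrefl. Qed.

Definition underlying D : graph V :=
  Graph (underlying_sym D) (underlying_irrefl D).

Definition orientation_of D G := underlying D =2 G.

Definition dipath D (u v : V) (p : seq V) : bool :=
  [&& path D u p, last u p == v & uniq (u :: p)].

(* [is_dist D u v k] says that d_D(u,v) = k; it holds for no k when v cannot
   be reached from u (infinite distance). *)
Definition is_dist D (u v : V) (k : nat) : Prop :=
  (exists2 p, dipath D u v p & size p = k) /\
  (forall p, dipath D u v p -> k <= size p).

Definition dist_from1_to D (u v : V) (m : nat) : Prop :=
  exists2 k, is_dist D u v k & 1 <= k <= m.

Definition del_rel D (x : V) : rel {y : V | y != x} :=
  fun y z => D (val y) (val z).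

Lemma del_asym D x (u v : {y : V | y != x}) :
  @del_rel D x u v -> ~~ @del_rel D x v u.
Proof. exact: arc_asym. Qed.

Definition del_vertex D (x : V) : digraph {y : V | y != x} :=
  Digraph (@del_asym D x).

End Digraphs.

Definition vtx (V : finType) (x y : V) (yx : y != x) : {z : V | z != x} :=
  exist _ y yx.

Section Competition.

Variable V : finType.
Implicit Types (D : digraph V) (G : graph V).

(* The disequality proofs place u and w in D - v, and v and w in D - u; they
   also express that u, v, w are pairwise distinct. *)
Definition step_compete (i j : nat) D (u v : V) : Prop :=
  exists (w : V) (uv : u != v) (wv : w != v) (vu : v != u) (wu : w != u),
    let du := dist_from1_to (del_vertex D v) (vtx uv) (vtx wv) in
    let dv := dist_from1_to (del_vertex D u) (vtx vu) (vtx wu) in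
    (du i /\ dv j) \/ (du j /\ dv i).

Definition step_competitive (i j : nat) D : Prop :=
  forall u v : V, u != v -> step_compete i j D u v.

Definition step_competitively_orientable (i j : nat) G : Prop :=
  exists D : digraph V, orientation_of D G /\ step_competitive i j D.

End Competition.

Section CompleteTripartite.

Variables n1 n2 n3 : nat.

Definition tripartite_vertex : finType := ('I_n1 + 'I_n2 + 'I_n3)%type.

Definition part (x : tripartite_vertex) : nat :=
  match x with
  | inl (inl _) => 0
  | inl (inr _) => 1
  | inr _ => 2
  end.

Definition tripartite_rel : rel tripartite_vertex :=
  fun x y => part x != part y.

Lemma tripartite_sym : symmetric tripartite_rel.
Proof. by move=> x y; rewrite /tripartite_rel eq_sym. Qed.

Lemma tripartite_irrefl : irreflexive tripartite_rel.
Proof. by move=> x; rewrite /tripartite_rel eqxx. Qed.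

Definition complete_tripartite : graph tripartite_vertex :=
  Graph tripartite_sym tripartite_irrefl.

End CompleteTripartite.

(* Main.v *)
Require Import Defs.
From mathcomp Require Import all_boot.
From mathcomp Require Import zify.

(* Sufficiency: replacing the vertices of a competitive digraph by independent
   sets of twins keeps it competitive, since twins have a common out-neighbour;
   so it is enough to orient K_{2,2,2}, K_{3,3,1} (with steps (1,2)) and
   K_{4,2,1} (with steps (2,2)).

   Necessity: in a competitive orientation all out-degrees are at least 2. If
   n2 + n3 <= 3, every vertex of the large part then has at most n2 + n3 - 2
   in-neighbours, and counting the arcs into that part excludes n2 + n3 = 2 and
   forces n1 >= 4 when n2 = 2. Moreover, if i = 1 or j = 1, the prey w of a
   competing pair has two in-neighbours; hence when n2 = 2 and n3 = 1, two
   vertices outside the large part can only compete for the third one, and the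
   three such pairs give contradictory orientations. *)

(** * Short distances and the end arcs of shortest paths *)

Section Distances.

Variables (V : finType) (D : digraph V).
Implicit Types u v w x : V.

Lemma arc_dist u v m : 0 < m -> D u v -> dist_from1_to D u v m.
Proof.
move=> m0 uv; have uNv : u != v by apply: contraTneq uv => ->; rewrite arc_irrefl.
exists 1 => //; split; first by exists [:: v]; rewrite //= /dipath /= uv inE uNv eqxx.
by case=> // /and3P[_ /= /eqP uE]; rewrite uE eqxx in uNv.
Qed.

(** The distance is 1 or 2, depending on whether there is an arc from [u] to [v]. *)
Lemma arc2_dist u x v m :
  1 < m -> u != v -> D u x -> D x v -> dist_from1_to D u v m.
Proof.
move=> m1 uNv ux xv; case: (boolP (D u v)) => [|uv]; first exact/arc_dist/ltnW.
have uNx : u != x by apply: contraTneq ux => ->; rewrite arc_irrefl.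
have xNv : x != v by apply: contraTneq xv => ->; rewrite arc_irrefl.
exists 2 => //; split.
  by exists [:: x; v]; rewrite //= /dipath /= ux xv !inE negb_or uNx uNv xNv eqxx.
case=> [|y [|z p]] // /and3P[/=]; first by move=> _ /eqP uE; rewrite uE eqxx in uNv.
by move=> /andP[uy _] /eqP yE; rewrite -yE uy in uv.
Qed.

Lemma dist_out u v m : dist_from1_to D u v m -> exists y, D u y.
Proof.
by case=> k [[[|y p]] /and3P[/= up _ _] <- _] //; case/andP: up; exists y.
Qed.

Lemma dist_in u v m : dist_from1_to D u v m -> exists y, D y v.
Proof.
case=> k [[p]]; case: (lastP p) => [_ <- //|q z] /and3P[+ + _] _ _ _.
rewrite last_rcons rcons_path => /andP[_ qz] /eqP <-.
by exists (last u q).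
Qed.

Lemma dist1_arc u v : dist_from1_to D u v 1 -> D u v.
Proof.
case=> k [[p]] /and3P[up /eqP pv _] pk _ k1.
have {pk k1}: size p = 1 by lia.
by case: p up pv => [|y []] //= /andP[+ _] <-.
Qed.

End Distances.

(** * Local consequences of competitiveness *)

Section Necessity.

Variables (V : finType) (D : digraph V) (i j : nat).
Hypothesis compD : step_competitive i j D.
Implicit Types u v w y : V.

Lemma out_avoiding u v : u != v -> exists2 y, y != v & D u y.
Proof.
move=> /compD[w [uv [wv [vu [wu [] []]]]]] /dist_out [[y yv] uy] _; by exists y.
Qed.

(** Competing with an out-neighbour [y] forces [u] to have a second one. *)
Lemma outdeg_ge2 u v : u != v -> 1 < \sum_y D u y.
Proof.
move=> /out_avoiding[y _ uy].
have uNy : u != y by apply: contraTneq uy => ->; rewrite arc_irrefl.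
have [z zNy uz] := out_avoiding _ _ uNy.
by rewrite (bigD1 y) //= (bigD1 z) //= uy uz.
Qed.

(** One competitor reaches [w] by an arc; the path of the other avoids it, so its last arc gives a
    second in-neighbour of [w]. *)
Lemma compete_prey u v : i = 1 \/ j = 1 -> u != v ->
  exists w, [/\ w != u, w != v &
    (D u w /\ exists2 y, y != u & D y w) \/ (D v w /\ exists2 y, y != v & D y w)].
Proof.
move=> ij1 /compD[w [uv [wv [vu [wu H]]]]]; exists w; split=> //.
case: ij1 => ij1; rewrite ij1 in H.
- by case: H => -[]; [move=> /dist1_arc uw /dist_in[[y yu] yw]; left
                     | move=> /dist_in[[y yv] yw] /dist1_arc vw; right];
    (split; [|exists y]).
- by case: H => -[]; [move=> /dist_in[[y yv] yw] /dist1_arc vw; right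
                     | move=> /dist1_arc uw /dist_in[[y yu] yw]; left];
    (split; [|exists y]).
Qed.

End Necessity.

(** * Arc counts in tripartite orientations *)

Section Tripartite.

Variables n1 n2 n3 : nat.
Local Notation V := (tripartite_vertex n1 n2 n3).
Implicit Types D : digraph V.

(** Arcs become 0/1 numbers here, so that degree counts can be left to [lia]. *)
Lemma orientation_arcs D : orientation_of D (complete_tripartite n1 n2 n3) ->
  forall u v, (D u v + D v u = (part u != part v))%N.
Proof.
move=> oD u v; have /= <- : underlying D u v = (part u != part v) by apply: oD.
rewrite /underlying_rel; have := @arc_asym _ D u v.
by case: (D u v) (D v u) => [] [] //= /(_ isT).
Qed.

Lemma big_tripartite (F : V -> nat) :
  \sum_y F y = \sum_(x < n1) F (inl (inl x)) + \sum_(x < n2) F (inl (inr x))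
             + \sum_(x < n3) F (inr x).
Proof. by rewrite !big_sumType. Qed.

End Tripartite.

Lemma n11_not_orientable i j n : 0 < n ->
  ~ step_competitively_orientable i j (complete_tripartite n 1 1).
Proof.
move=> n0 [D [/orientation_arcs arcs comp]].
pose a : tripartite_vertex n 1 1 := inl (inr ord0).
pose c : tripartite_vertex n 1 1 := inr ord0.
have := outdeg_ge2 _ _ _ _ comp a c isT.
rewrite big_tripartite !big_ord1 -/a -/c arc_irrefl addn0 big1; first by case: (D a c).
(* The vertex [x] has only the neighbours [a] and [c], so both are out-neighbours; hence [a] sends
   no arc to the large part. *)
move=> x _; have := outdeg_ge2 _ _ _ _ comp (inl (inl x)) c isT.
rewrite big_tripartite !big_ord1 -/a -/c big1.
  have /= := arcs a (inl (inl x)); lia.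
by move=> y _; have /= := arcs (inl (inl x)) (inl (inl y)); lia.
Qed.

(** * Orientations of $K_{n,2,1}$ *)

Section N21.

Variables (i j n : nat) (D : digraph (tripartite_vertex n 2 1)).
Hypothesis oD : orientation_of D (complete_tripartite n 2 1).
Hypothesis compD : step_competitive i j D.

Let arcs := orientation_arcs _ _ _ _ oD.
Let a : tripartite_vertex n 2 1 := inl (inr ord0).
Let b : tripartite_vertex n 2 1 := inl (inr (lift ord0 ord0)).
Let c : tripartite_vertex n 2 1 := inr ord0.

Lemma sum_n21 (F : tripartite_vertex n 2 1 -> nat) :
  \sum_y F y = \sum_(x < n) F (inl (inl x)) + (F a + F b + F c).
Proof. by rewrite big_tripartite big_ord_recl !big_ord1 !addnA. Qed.

Lemma vertex_n21 (P : tripartite_vertex n 2 1 -> Prop) :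
  (forall x, P (inl (inl x))) -> P a -> P b -> P c -> forall y, P y.
Proof.
move=> Px Pa Pb Pc [[x|x]|x]; first exact: Px; last by rewrite (ord1 x).
by case: (unliftP ord0 x) => [z|] ->; rewrite ?(ord1 z).
Qed.

Lemma indeg_le1 (x : 'I_n) :
  D a (inl (inl x)) + D b (inl (inl x)) + D c (inl (inl x)) <= 1.
Proof.
have := outdeg_ge2 _ _ _ _ compD (inl (inl x)) c isT.
rewrite sum_n21 big1.
  have /= := arcs a (inl (inl x)); have /= := arcs b (inl (inl x)).
  have /= := arcs c (inl (inl x)); lia.
by move=> y _; have /= := arcs (inl (inl x)) (inl (inl y)); lia.
Qed.

Lemma n21_ge4 : 4 <= n.
Proof.
have : \sum_(x < n) (D a (inl (inl x)) + D b (inl (inl x)) + D c (inl (inl x)))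
       <= \sum_(x < n) 1 by apply: leq_sum => x _; apply: indeg_le1.
rewrite sum1_card card_ord !big_split /=.
(* The out-degrees of [a], [b], [c] add up to at least 6, and only two arcs run among these
   vertices, so at least four enter the large part. *)
have := outdeg_ge2 _ _ _ _ compD a c isT; have := outdeg_ge2 _ _ _ _ compD b c isT.
have := outdeg_ge2 _ _ _ _ compD c a isT; rewrite !sum_n21.
have /= := arcs a a; have /= := arcs b b; have /= := arcs c c.
have /= := arcs a b; have /= := arcs a c; have /= := arcs b c.
lia.
Qed.

Lemma n21_prey u v : i = 1 \/ j = 1 -> u != v ->
  exists w, [/\ part w != 0, w != u, w != v & D u w || D v w].
Proof.
move=> ij1 /(compete_prey _ _ _ _ compD _ _ ij1)[w [wu wv uvw]]; exists w.
split=> //; last by case: uvw => -[-> _]; rewrite ?orbT.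
(* A prey has two in-neighbours, which no vertex of the large part has. *)
suff one_in (x : 'I_n) y z : D y (inl (inl x)) -> D z (inl (inl x)) -> y = z.
  apply/negP; case: w {wu wv} uvw => [[x|]|] //= uvw _.
  case: uvw => -[yx [z +]] /(one_in x _ _ yx) yz; by rewrite yz eqxx.
have xx t : D (inl (inl t)) (inl (inl x)) = false.
  by have /= := arcs (inl (inl t)) (inl (inl x)); lia.
move: y z; elim/vertex_n21=> [t|||]; elim/vertex_n21=> [s|||] //;
  by [rewrite xx | rewrite (xx s) | have := indeg_le1 x => + yx zx; rewrite yx zx; lia].
Qed.

Lemma n21_ge2 : i != 1 /\ j != 1.
Proof.
suff nij1 : ~ (i = 1 \/ j = 1) by split; apply/eqP => E; apply: nij1; auto.
move=> ij1.
(* Each pair among [a], [b], [c] preys on the third vertex; as [a] and [b] are not adjacent, the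
   other two pairs force both arcs out of [c]. *)
have : D a c || D b c.
  have [w] := n21_prey a b ij1 isT; elim/vertex_n21: w => [x|||] [] //.
have : D c b.
  have [w] := n21_prey a c ij1 isT; elim/vertex_n21: w => [x|||] [] //.
  by have /= := arcs a b; lia.
have : D c a.
  have [w] := n21_prey b c ij1 isT; elim/vertex_n21: w => [x|||] [] //.
  by have /= := arcs a b; lia.
have /= := arcs a c; have /= := arcs b c; lia.
Qed.

End N21.

(** * Lifting competition to blow-ups *)

Section Blowup.

Variables (r : rel nat) (n : nat).

(* [w] is reached from [u] in at most [min k 2] steps, avoiding [v]. *)
Definition reaches k (v u w : nat) : bool :=
  r u w || [&& 1 < k & has (fun x => [&& x != v, r u x & r x w]) (iota 0 n)].

Definition competes i j (u v : nat) : bool :=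
  has (fun w => reaches i v u w && reaches j u v w
             || reaches j v u w && reaches i u v w) (iota 0 n).

(* The case [u = v] amounts to the competition of twins. *)
Definition all_compete i j : bool :=
  all (fun u => all (competes i j u) (iota 0 n)) (iota 0 n).

Variables (V : finType) (D : digraph V) (f : V -> nat).
Hypothesis fD : forall u v, D u v = r (f u) (f v).
Hypothesis f_lt : forall u, f u < n.
Hypothesis f_surj : forall y, y < n -> exists u, f u = y.

(** Equality would give a loop or, after lifting the middle vertex, a directed 2-cycle in [D]. *)
Lemma reaches_neq k v u w : reaches k v (f u) (f w) -> w != u.
Proof.
apply: contraTneq => ->; rewrite /reaches -fD arc_irrefl /=.
apply/negP => /andP[_ /hasP[x]]; rewrite mem_iota /= => /f_surj[y <-].
by rewrite -!fD => /and3P[_ uy]; apply/negP/arc_asym.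
Qed.

Lemma reaches_dist k m (v u w : V) (uv : u != v) (wv : w != v) :
  0 < m -> k <= m -> reaches k (f v) (f u) (f w) ->
  dist_from1_to (del_vertex D v) (vtx uv) (vtx wv) m.
Proof.
move=> m0 km uw; have wNu := reaches_neq _ _ _ _ uw.
case/orP: uw; first by rewrite -fD => uw; apply: arc_dist.
case/andP=> k1 /hasP[y]; rewrite mem_iota /= => /f_surj[x <-].
rewrite -!fD => /and3P[xv ux xw].
have {}xv : x != v by apply: contraNneq xv => ->.
apply: (@arc2_dist _ (del_vertex D v) _ (vtx xv)) => //; first exact: leq_trans km.
by rewrite -val_eqE eq_sym.
Qed.

Lemma blowup_competitive i0 j0 i j : 0 < i -> 0 < j -> i0 <= i -> j0 <= j ->
  all_compete i0 j0 -> step_competitive i j D.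
Proof.
move=> i_gt0 j_gt0 i0i j0j /allP comp u v uv; have vu : v != u by rewrite eq_sym.
have /comp/allP/(_ (f v)) : f u \in iota 0 n by rewrite mem_iota /=.
rewrite mem_iota /= => /(_ (f_lt v))/hasP[y]; rewrite mem_iota /= => /f_surj[w <-] uvw.
have [wu wv] : w != u /\ w != v.
  by case/orP: uvw => /andP[/reaches_neq wu /reaches_neq wv].
exists w, uv, wv, vu, wu => /=.
by case/orP: uvw => /andP[uw vw]; [left|right]; split; apply: reaches_dist; eassumption.
Qed.

End Blowup.

(** * Blow-ups of oriented complete tripartite graphs *)

Section TripartiteBlowup.

(* An orientation of K_{m1,m2,m3} is given on the vertices 0, 1, ...,
   numbered part by part, by the list of its out-neighbourhoods. *)
Definition base_rel (out : seq (seq nat)) : rel nat :=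
  fun y z => z \in nth [::] out y.

Definition base_part (m1 m2 y : nat) : nat := (m1 <= y) + (m1 + m2 <= y).

Definition base_oriented m1 m2 m3 out : bool :=
  let r := base_rel out in let vs := iota 0 (m1 + m2 + m3) in
  all (fun y => all (fun z =>
    r y z + r z y == (base_part m1 m2 y != base_part m1 m2 z)) vs) vs.

Variables n1 n2 n3 m1 m2 m3 : nat.
Hypothesis bounds : [/\ 0 < m1 <= n1, 0 < m2 <= n2 & 0 < m3 <= n3].

(** The surplus vertices of each part become twins of its last base vertex. *)
Definition collapse (x : tripartite_vertex n1 n2 n3) : nat :=
  match x with
  | inl (inl k) => minn k m1.-1
  | inl (inr k) => m1 + minn k m2.-1
  | inr k => m1 + m2 + minn k m3.-1
  end.

Lemma collapse_lt x : collapse x < m1 + m2 + m3.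
Proof. by case: bounds; case: x => [[x|x]|x] /=; lia. Qed.

Lemma collapse_part x : base_part m1 m2 (collapse x) = part x.
Proof. by rewrite /base_part; case: bounds; case: x => [[x|x]|x] /=; lia. Qed.

Lemma collapse_surj y : y < m1 + m2 + m3 -> exists x, collapse x = y.
Proof.
case: bounds => m1P m2P m3P ym.
case: (ltnP y m1) => ym1.
  have lt : y < n1 by lia.
  by exists (inl (inl (Ordinal lt))) => /=; lia.
case: (ltnP y (m1 + m2)) => ym2.
  have lt : y - m1 < n2 by lia.
  by exists (inl (inr (Ordinal lt))) => /=; lia.
have lt : y - (m1 + m2) < n3 by lia.
by exists (inr (Ordinal lt)) => /=; lia.
Qed.

Lemma blowup_orientable i0 j0 i j out :
  0 < i -> 0 < j -> i0 <= i -> j0 <= j ->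
  base_oriented m1 m2 m3 out ->
  all_compete (base_rel out) (m1 + m2 + m3) i0 j0 ->
  step_competitively_orientable i j (complete_tripartite n1 n2 n3).
Proof.
move=> i_gt0 j_gt0 i0i j0j /allP or_out comp.
pose r u v := base_rel out (collapse u) (collapse v).
have arcs u v : r u v + r v u = (part u != part v).
  have /or_out/allP : collapse u \in iota 0 (m1 + m2 + m3).
    by rewrite mem_iota collapse_lt.
  move=> /(_ (collapse v)); rewrite mem_iota collapse_lt => /(_ isT)/eqP.
  by rewrite !collapse_part.
have asym u v : r u v -> ~~ r v u.
  by have := arcs u v; case: (part u != part v); lia.
exists (Digraph asym); split.
  move=> u v; rewrite /= /underlying_rel /= /tripartite_rel.
  by have := arcs u v; case: (part u != part v); lia.
by apply: blowup_competitive i0i j0j comp => //;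
  [apply: collapse_lt | apply: collapse_surj].
Qed.

End TripartiteBlowup.

(** A directed triangle with every vertex doubled: the tail of an arc reaches the out-neighbours of
    the head through the twin of the head. *)
Definition out222 : seq (seq nat) :=
  [:: [:: 4; 5]; [:: 4; 5]; [:: 0; 1]; [:: 0; 1]; [:: 2; 3]; [:: 2; 3]].

Definition out331 : seq (seq nat) :=
  [:: [:: 5; 6]; [:: 5; 6]; [:: 3; 4]; [:: 0; 1]; [:: 0; 1]; [:: 2; 6];
      [:: 2; 3; 4]].

(** Each of the vertices 0 to 3 has exactly one in-neighbour, as the count in [n21_ge4] forces when
    [n] is 4. *)
Definition out421 : seq (seq nat) :=
  [:: [:: 5; 6]; [:: 5; 6]; [:: 4; 6]; [:: 4; 6]; [:: 0; 1]; [:: 2; 3];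
      [:: 4; 5]].

Theorem theorem2 (i j n1 n2 n3 : nat) (i_gt0 : 0 < i) (j_gt0 : 0 < j)
  (ij_neq11 : (i, j) <> (1, 1))
  (n1_gt0 : 0 < n1) (n2_gt0 : 0 < n2) (n3_gt0 : 0 < n3)
  (n12 : n1 >= n2) (n23 : n2 >= n3) :
  step_competitively_orientable i j (complete_tripartite n1 n2 n3) <->
  [\/ n3 >= 2,
      n2 >= 3 /\ n3 = 1
    | [/\ i >= 2, j >= 2, n1 >= 4, n2 = 2 & n3 = 1]].
Proof.
split=> [orG|].
  case: (ltnP 1 n3) => n3P; first exact: Or31.
  have n3E : n3 = 1 by lia.
  case: (ltnP 2 n2) => n2P; first by apply: Or32.
  have [n2E|n2E] : n2 = 1 \/ n2 = 2 by lia.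
    by rewrite n2E n3E in orG; case: (n11_not_orientable i j n1).
  rewrite n2E n3E in orG; case: orG => D [oD compD].
  have := n21_ge4 _ _ _ _ oD compD; have [] := n21_ge2 _ _ _ _ oD compD.
  by move=> *; apply: Or33; split; lia.
(* So (2,1) or (1,2) lies componentwise below [(i, j)], and the base orientation is checked for that
   pair. *)
have ij2 : 1 < i \/ 1 < j.
  suff : ~ (i = 1 /\ j = 1) by lia.
  by case=> iE jE; apply: ij_neq11; rewrite iE jE.
case=> [n3P|[n2P n3P]|[i2 j2 n1P n2P n3P]].
- case: ij2 => ij2.
    by apply: (@blowup_orientable _ _ _ 2 2 2 _ 2 1 _ _ out222) => //; split; lia.
  by apply: (@blowup_orientable _ _ _ 2 2 2 _ 1 2 _ _ out222) => //; split; lia.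
- case: ij2 => ij2.
    by apply: (@blowup_orientable _ _ _ 3 3 1 _ 2 1 _ _ out331) => //; split; lia.
  by apply: (@blowup_orientable _ _ _ 3 3 1 _ 1 2 _ _ out331) => //; split; lia.
- by apply: (@blowup_orientable _ _ _ 4 2 1 _ 2 2 _ _ out421) => //; split; lia.
Qed.
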